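(* Let $1\le p<\infty$, let $\mathcal{X}$ be a Banach space, and let $(\{f_n\}_n,\{\tau_n\}_n)$ and $(\{g_n\}_n,\{\omega_n\}_n)$ be two Lipschitz p-SFs for a non-empty subset $\mathcal{M}\subseteq\mathcal{X}$ which are orthogonal. If $A,B:\mathcal{M}\to\mathcal{M}$ are bi-Lipschitz maps, $C,D:\mathcal{X}\to\mathcal{X}$ are bounded linear operators, $C(\mathcal{M})\subseteq\mathcal{M}$, $D(\mathcal{M})\subseteq\mathcal{M}$ and $CA+DB=I_{\mathcal{M}}$, then $$(\{f_nA+g_nB\}_n,\ \{C\tau_n+D\omega_n\}_n)$$ is a Lipschitz p-SF for $\mathcal{M}$. In particular, if scalars $a,b,c,d$ satisfy $ca+db=1$, then $(\{af_n+bg_n\}_n,\{c\tau_n+d\omega_n\}_n)$ is a Lipschitz p-SF for $\mathcal{M}$.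
   Context: Let $\mathcal{X}$ be a real or complex Banach space with scalar field $\mathbb{K}$, $\mathcal{M}$ a non-empty subset of $\mathcal{X}$ (not necessarily a subspace), and $1\le p<\infty$. $I_{\mathcal{M}}$ is the identity map of $\mathcal{M}$. $\operatorname{Lip}(\mathcal{M},\mathbb{K})$ is the set of Lipschitz functions from $\mathcal{M}$ to $\mathbb{K}$. A map $T$ between subsets of normed spaces is bi-Lipschitz if there are $a,b>0$ with $a\|x-y\|\le\|Tx-Ty\|\le b\|x-y\|$ for all $x,y$. Juxtaposition of maps denotes composition. Definition. Let $\{\tau_n\}_n$ be a sequence in $\mathcal{M}$ and $\{f_n\}_n$ a sequence in $\operatorname{Lip}(\mathcal{M},\mathbb{K})$. The pair $(\{f_n\}_n,\{\tau_n\}_n)$ is a Lipschitz p-approximate Schauder frame (Lipschitz p-ASF) for $\mathcal{M}$ if: (1) the analysis map $\theta_f:\mathcal{M}\ni x\mapsto\{f_n(x)\}_n\in\ell^p(\mathbb{N})$ is a well-defined Lipschitz map; (2) the synthesis operator $\theta_\tau:\ell^p(\mathbb{N})\ni\{a_n\}_n\mapsto\sum_{n=1}^\infty a_n\tau_n\in\mathcal{X}$ is a well-defined bounded linear operator; (3) the Lipschitz frame map $S_{f,\tau}:\mathcal{M}\ni x\mapsto\sum_{n=1}^\infty f_n(x)\tau_n\in\mathcal{M}$ is a well-defined invertible (bijective) bi-Lipschitz map, and $x=\sum_{n=1}^\infty f_n(x)S_{f,\tau}^{-1}\tau_n$ for all $x\in\mathcal{M}$. If $S_{f,\tau}=I_{\mathcal{M}}$,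 it is called a Lipschitz p-Schauder frame (Lipschitz p-SF). Definition. A Lipschitz p-ASF $(\{g_n\}_n,\{\omega_n\}_n)$ for $\mathcal{M}$ is orthogonal for a Lipschitz p-ASF $(\{f_n\}_n,\{\tau_n\}_n)$ for $\mathcal{M}$ if $0=\sum_{n=1}^\infty g_n(x)\tau_n=\sum_{n=1}^\infty f_n(x)\omega_n$ for all $x\in\mathcal{M}$.
   Formalization: The vectors Cτ_n+Dω_n (or cτ_n+dω_n) need not lie in M, as the definition demands, so the claim can fail. Proved: all other p-SF conditions always hold (sequence taken in X), and the pair is a full Lipschitz p-SF for M whenever these vectors all lie in M. *)

(* Defs.v *)
From HB Require Import structures.
From mathcomp Require Import all_boot all_order all_algebra.
From mathcomp Require Import complex.
From mathcomp Require Import all_classical all_reals all_analysis.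
Set Implicit Arguments.
Unset Strict Implicit.
Unset Printing Implicit Defensive.
Import Order.TTheory GRing.Theory Num.Theory.
Import numFieldNormedType.Exports.
Local Open Scope classical_set_scope.
Local Open Scope ring_scope.

Variant scalar_kind := RealScalars | ComplexScalars.

Definition scalars (R : realType) (k : scalar_kind) : numFieldType :=
  match k with
  | RealScalars => R
  | ComplexScalars => R[i]
  end.

(* The library norm of a normed module over K takes its values in K (for
   K = R[i], in the nonnegative reals of R[i]); [modulus] is the absolute value
   of a scalar as an element of R. *)
Definition modulus (R : realType) (k : scalar_kind) : scalars R k -> R :=
  match k with
  | RealScalars => fun x : R => `|x|
  | ComplexScalars => fun z : R[i] => Normc.normc z
  end.

Definition rnorm (R : realType) (k : scalar_kind)
  (X : normedModType (scalars R k)) (x : X) : R := modulus `|x|.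

Definition lp_norm (R : realType) (k : scalar_kind) (p : R)
    (a : nat -> scalars R k) : \bar R :=
  Lnorm (@counting nat R) p%:E (fun n => (modulus (a n))%:E).

Definition in_lp (R : realType) (k : scalar_kind) (p : R)
    (a : nat -> scalars R k) : Prop :=
  (lp_norm p a < +oo)%E.

(* Throughout, a map defined on a subset M of X is represented by a function on
   all of X, of which only the values on M matter. *)

Definition bounded_operator (K : numFieldType) (X : normedModType K)
    (C : {linear X -> X}) : Prop :=
  exists L : K, forall x, `|C x| <= L * `|x|.

Definition bi_lipschitz (K : numFieldType) (X : normedModType K)
    (M : set X) (T : X -> X) : Prop :=
  exists a b : K, [/\ 0 < a, 0 < b &
    forall x y, M x -> M y ->
      a * `|x - y| <= `|T x - T y| /\ `|T x - T y| <= b * `|x - y|].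

Section frames.
Variables (R : realType) (k : scalar_kind).
Variable X : completeNormedModType (scalars R k).
Variables (M : set X) (p : R).
Implicit Types (f g : nat -> X -> scalars R k) (tau omega : nat -> X).

Definition lipschitz_functional (h : X -> scalars R k) : Prop :=
  [lipschitz (h x : (scalars R k)^o) | x in M].

Definition analysis_lipschitz f : Prop :=
  (forall x, M x -> in_lp p (f ^~ x)) /\
  exists L : R, forall x y, M x -> M y ->
    (lp_norm p (fun n => (f n x - f n y)%R) <= (L * rnorm (x - y))%:E)%E.

Definition synthesis tau (a : nat -> scalars R k) : X :=
  limn (series (fun n => a n *: tau n)).

Definition synthesis_bounded tau : Prop :=
  [/\ forall a, in_lp p a -> cvgn (series (fun n => a n *: tau n)),
      forall (c : scalars R k) a b, in_lp p a -> in_lp p b ->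
        synthesis tau (fun n => c * a n + b n) =
        c *: synthesis tau a + synthesis tau b
    & exists L : R, forall a, in_lp p a ->
        ((rnorm (synthesis tau a))%:E <= L%:E * lp_norm p a)%E].

Definition frame_map f tau (x : X) : X :=
  limn (series (fun n => f n x *: tau n)).

(* ['pinv_(fun=> 0) M S] is the inverse of the bijection S : M -> M
   (extended by 0 outside M). *)
Definition frame_map_invertible f tau : Prop :=
  let S := frame_map f tau in
  [/\ forall x, M x -> cvgn (series (fun n => f n x *: tau n)),
      set_bij M M S,
      bi_lipschitz M S
    & forall x, M x ->
        series (fun n => f n x *: 'pinv_(fun=> 0) M S (tau n)) @ \oo --> x].

Definition lipschitz_pASF f tau : Prop :=
  [/\ forall n, M (tau n),
      forall n, lipschitz_functional (f n),
      analysis_lipschitz f,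
      synthesis_bounded tau
    & frame_map_invertible f tau].

Definition lipschitz_pSF f tau : Prop :=
  lipschitz_pASF f tau /\ forall x, M x -> frame_map f tau x = x.

(* What remains of [lipschitz_pSF] when the tau n are only required to lie
   in X: if the frame map exists and is the identity of M, its bijectivity,
   bi-Lipschitz property and the reconstruction formula are automatic. *)
Definition lipschitz_pSF_in_space f tau : Prop :=
  [/\ forall n, lipschitz_functional (f n),
      analysis_lipschitz f,
      synthesis_bounded tau
    & forall x, M x -> series (fun n => f n x *: tau n) @ \oo --> x].

Definition orthogonal_pASF g omega f tau : Prop :=
  forall x, M x ->
    series (fun n => g n x *: tau n) @ \oo --> (0 : X) /\
    series (fun n => f n x *: omega n) @ \oo --> (0 : X).

End frames.

(* Main.v *)
Require Import Defs.
From HB Require Import structures.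
From mathcomp Require Import all_boot all_order all_algebra.
From mathcomp Require Import complex.
From mathcomp Require Import all_classical all_reals all_analysis.
Import Order.TTheory GRing.Theory Num.Theory.
Import numFieldNormedType.Exports.
Local Open Scope classical_set_scope.
Local Open Scope ring_scope.

(* Write h n = f' n + g' n, where (f', g') is (f A, g B), respectively (a f, b g).
   The analysis map of h is Lipschitz by Minkowski's inequality, and the synthesis
   operator of C tau + D omega is C theta_tau + D theta_omega. The product
   expands into C S_{f',tau} + D S_{f',omega} + C S_{g',tau} + D S_{g',omega};
   the two mixed terms vanish by orthogonality, and what is left is
   C A + D B = id, respectively c a + d b = 1. As multiplication by a need not map M
   into M, both cases are instances of a statement about arbitrary P, Q : X -> X
   with C P + D Q = id on M. *)

(** * Moduli of real and complex scalars *)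

Section scalar_modulus.
Context {R : realType} {k : scalar_kind}.
Implicit Types x y : scalars R k.

Lemma modulus_ge0 x : 0 <= modulus x.
Proof.
case: k x => /= [x|x]; first exact: normr_ge0.
(* The norm of [R[i]] is [normc] embedded into [R[i]], and [lecR] says that this embedding preserves
   and reflects the order. *)
by rewrite -lecR; exact: (@normr_ge0 R[i] R[i] x).
Qed.

Lemma modulusM x y : modulus (x * y) = modulus x * modulus y.
Proof.
case: k x y => /= [x y|x y]; first exact: normrM.
exact: Normc.normcM.
Qed.

Lemma ler_modulusD x y : modulus (x + y) <= modulus x + modulus y.
Proof.
case: k x y => /= [x y|x y]; first exact: ler_normD.
exact: le_normcD.
Qed.

(** On nonnegative scalars the norm is the identity. This carries inequalities between norms with
    values in the scalar field over to [rnorm]. *)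
Lemma ler_modulus x y : 0 <= x -> x <= y -> modulus x <= modulus y.
Proof.
case: k x y => /= [x y x0 xy|x y x0 xy].
  by rewrite !ger0_norm// (le_trans x0).
rewrite -lecR -[X in X <= _]/(`|x|) -[X in _ <= X]/(`|y|).
by rewrite !ger0_norm// (le_trans x0).
Qed.

End scalar_modulus.

(** * The norm as a real number *)

Section real_valued_norm.
Context {R : realType} {k : scalar_kind} {X : normedModType (scalars R k)}.
Implicit Types (x y : X) (c : scalars R k).

Lemma rnorm_ge0 x : 0 <= rnorm x.
Proof. exact: modulus_ge0. Qed.

Lemma ler_rnormD x y : rnorm (x + y) <= rnorm x + rnorm y.
Proof.
apply: le_trans (ler_modulusD _ _).
by apply: ler_modulus => //; exact: ler_normD.
Qed.

Lemma ler_rnormM c x y : `|x| <= c * `|y| -> rnorm x <= modulus c * rnorm y.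
Proof. by move=> xy; rewrite /rnorm -modulusM; exact: ler_modulus. Qed.

End real_valued_norm.

(** * The norm of the sequence space *)

Section lp_norm_theory.
Context {R : realType} {k : scalar_kind} (p : R).
Hypothesis p_ge1 : 1 <= p.
Implicit Types a b : nat -> scalars R k.

Let p_gt0 : 0 < p. Proof. exact: lt_le_trans p_ge1. Qed.

Lemma lp_norm_ge0 a : (0 <= lp_norm p a)%E.
Proof. exact: Lnorm_ge0. Qed.

(** Minkowski's inequality for the counting measure, applied to the real sequences of moduli; the
    triangle inequality for [modulus] then compares the sums term by term. *)
Lemma lp_normD a b :
  (lp_norm p (fun n => (a n + b n)%R) <= lp_norm p a + lp_norm p b)%E.
Proof.
have mink := @minkowski_EFin _ _ _ (@counting nat R)
  (fun n => modulus (a n)) (fun n => modulus (b n)) p.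
apply: le_trans (mink _ _ p_ge1) => //.
rewrite /lp_norm !Lnorm_counting//.
have p_ge0 := ltW p_gt0.
apply: gt0_ler_poweR; first by rewrite invr_ge0.
1,2: by rewrite in_itv/= leey andbT; apply: nneseries_ge0 => *;
  rewrite lee_fin powR_ge0.
apply: lee_nneseries => [n _ _|n _]; first exact: poweR_ge0.
apply: gt0_ler_poweR; rewrite // ?in_itv/= ?leey ?lee_fin ?normr_ge0//.
by rewrite !ger0_norm ?addr_ge0 ?modulus_ge0//; exact: ler_modulusD.
Qed.

Lemma lp_normZ (c : scalars R k) a :
  lp_norm p (fun n => c * a n) = ((modulus c)%:E * lp_norm p a)%E.
Proof.
rewrite /lp_norm !Lnorm_counting//.
under eq_eseriesr => n _.
  rewrite modulusM abse_EFin normrM EFinM poweRM ?lee_fin//.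
  rewrite [(_ `^ p)%E in X in (X * _)%E]poweR_EFin.
  over.
rewrite nneseriesZl; last by move=> *; exact: poweR_ge0.
rewrite poweRM ?lee_fin ?powR_ge0//; last first.
  by apply: nneseries_ge0 => *; exact: poweR_ge0.
(* The factor left outside the series is the p-th root of the p-th power of [modulus c]. *)
by rewrite poweR_EFin -powRrM divff ?gt_eqF// powRr1// ger0_norm ?modulus_ge0.
Qed.

Lemma in_lpD a b : in_lp p a -> in_lp p b -> in_lp p (fun n => a n + b n).
Proof.
by move=> a_lp b_lp; apply: le_lt_trans (lp_normD _ _) _; exact: lte_add_pinfty.
Qed.

Lemma in_lpZ (c : scalars R k) a : in_lp p a -> in_lp p (fun n => c * a n).
Proof.
by move=> a_lp; rewrite /in_lp lp_normZ lte_mul_pinfty ?lee_fin ?modulus_ge0.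
Qed.

End lp_norm_theory.

(** * Bounded operators and bi-Lipschitz maps *)

Section bounded_operators.
Context {K : numFieldType} {X : normedModType K}.

Lemma bounded_operator_continuous (C : {linear X -> X}) :
  bounded_operator C -> continuous C.
Proof.
move=> [L CL]; apply: bounded_linear_continuous; apply/linear_boundedP.
(* [L] is an arbitrary scalar, so its norm serves as a real bound; [L] times the norm of [x]
   dominates a norm, hence is nonnegative and equal to its own norm. *)
near=> r => x; apply: (@le_trans _ _ (`|L| * `|x|)).
  rewrite -[`|x|]normr_id -normrM ger0_norm ?CL//.
  by apply: le_trans (CL x).
by rewrite ler_wpM2r//; near: r; apply: nbhs_pinfty_ge; exact: normr_real.
Unshelve. all: by end_near. Qed.

Lemma bounded_operator_scale (c : K) :
  bounded_operator (@GRing.scale K X c : {linear X -> X}).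
Proof. by exists `|c| => x; rewrite normrZ. Qed.

Lemma cvg_series_linear (C : {linear X -> X}) (a : nat -> K) (t : nat -> X) l :
  continuous C ->
  series (fun n => a n *: t n) @ \oo --> l ->
  series (fun n => a n *: C (t n)) @ \oo --> C l.
Proof.
move=> cC atl.
suff -> : series (fun n => a n *: C (t n)) = C \o series (fun n => a n *: t n).
  by apply: continuous_cvg => //; exact: cC.
apply/funext => n; rewrite /series/= linear_sum.
by apply: eq_bigr => i _; rewrite linearZ.
Qed.

Lemma bi_lipschitz_upper (M : set X) (T : X -> X) : bi_lipschitz M T ->
  exists2 b, 0 < b & forall x y, M x -> M y -> `|T x - T y| <= b * `|x - y|.
Proof.
by move=> [a [b [_ b0 Tab]]]; exists b => // x y Mx My; case: (Tab x y Mx My).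
Qed.

End bounded_operators.

(** * Lipschitz functionals and analysis maps *)

Section combinations.
Context {R : realType} {k : scalar_kind}.
Context {X : completeNormedModType (scalars R k)}.
Context (M : set X) (p : R).
Hypotheses (M_nonempty : M !=set0) (p_ge1 : 1 <= p).
Implicit Types (h : X -> scalars R k) (f g : nat -> X -> scalars R k).
Implicit Types (A : X -> X) (c : scalars R k) (tau omega : nat -> X).
Implicit Types C D : {linear X -> X}.

(** The library notion quantifies over all sufficiently large constants; a single positive constant
    is easier to compose and add. *)
Lemma lipschitz_functionalP h : lipschitz_functional M h <->
  exists2 L, 0 < L & forall x y, M x -> M y -> `|h x - h y| <= L * `|x - y|.
Proof.
split=> [/pinfty_ex_gt0[L L0 hL]|[L _ hL]].
  by exists L => // x y Mx My; exact: (hL (x, y)).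
(* A point of [M] makes the filter of sets containing all pairs from [M] proper. *)
have [z Mz] := M_nonempty.
apply: (@klipschitzW _ _ _ L); first exact: (@globally_properfilter _ _ (z, z)).
by move=> [x y] [/= Mx My]; exact: hL.
Qed.

Lemma lipschitz_functional_comp h A : set_fun M M A -> bi_lipschitz M A ->
  lipschitz_functional M h -> lipschitz_functional M (h \o A).
Proof.
move=> MA /bi_lipschitz_upper[b b0 Ab] /lipschitz_functionalP[L L0 hL].
apply/lipschitz_functionalP; exists (L * b); first exact: mulr_gt0.
move=> x y Mx My; apply: le_trans (hL _ _ (MA _ Mx) (MA _ My)) _.
by rewrite -mulrA ler_pM2l//; exact: Ab.
Qed.

Lemma lipschitz_functionalD h1 h2 :
  lipschitz_functional M h1 -> lipschitz_functional M h2 ->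
  lipschitz_functional M (fun x => h1 x + h2 x).
Proof.
move=> /lipschitz_functionalP[L1 L10 hL1] /lipschitz_functionalP[L2 L20 hL2].
apply/lipschitz_functionalP; exists (L1 + L2); first exact: addr_gt0.
move=> x y Mx My; rewrite opprD addrACA mulrDl.
by apply: le_trans (ler_normD _ _) _; apply: lerD; [exact: hL1|exact: hL2].
Qed.

Lemma lipschitz_functionalZ c h :
  lipschitz_functional M h -> lipschitz_functional M (fun x => c * h x).
Proof.
move=> /lipschitz_functionalP[L L0 hL]; apply/lipschitz_functionalP.
(* Adding 1 keeps the constant positive when [c] is 0. *)
exists ((`|c| + 1) * L); first by rewrite mulr_gt0// ltr_wpDl.
move=> x y Mx My; rewrite -mulrBr normrM -mulrA.
by rewrite ler_pM// ?lerDl//; exact: hL.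
Qed.

(** A nonnegative constant can multiply the Lipschitz estimate of an inner map. *)
Lemma analysis_lipschitz_ge0 f : analysis_lipschitz M p f ->
  (forall x, M x -> in_lp p (f ^~ x)) /\
  exists2 L : R, 0 <= L & forall x y, M x -> M y ->
    (lp_norm p (fun n => (f n x - f n y)%R) <= (L * rnorm (x - y))%:E)%E.
Proof.
move=> [f_lp [L fL]]; split=> //; exists `|L| => // x y Mx My.
apply: le_trans (fL _ _ Mx My) _.
by rewrite lee_fin ler_wpM2r ?rnorm_ge0 ?ler_norm.
Qed.

Lemma analysis_lipschitz_comp f A : set_fun M M A -> bi_lipschitz M A ->
  analysis_lipschitz M p f -> analysis_lipschitz M p (fun n => f n \o A).
Proof.
move=> MA /bi_lipschitz_upper[b b0 Ab] /analysis_lipschitz_ge0[f_lp [L L0 fL]].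
split=> [x Mx|]; first exact: f_lp (MA _ Mx).
exists (L * modulus b) => x y Mx My.
apply: le_trans (fL _ _ (MA _ Mx) (MA _ My)) _.
by rewrite lee_fin -mulrA ler_wpM2l//; apply: ler_rnormM; exact: Ab.
Qed.

Lemma analysis_lipschitzD f g :
  analysis_lipschitz M p f -> analysis_lipschitz M p g ->
  analysis_lipschitz M p (fun n x => f n x + g n x).
Proof.
move=> [f_lp [L1 fL]] [g_lp [L2 gL]]; split=> [x Mx|].
  by apply: in_lpD => //; [exact: f_lp|exact: g_lp].
exists (L1 + L2) => x y Mx My.
under [X in lp_norm p X]eq_fun do rewrite opprD addrACA.
apply: le_trans (lp_normD _ p_ge1 _ _) _.
by rewrite mulrDl EFinD; apply: leeD; [exact: fL|exact: gL].
Qed.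

Lemma analysis_lipschitzZ c f : analysis_lipschitz M p f ->
  analysis_lipschitz M p (fun n x => c * f n x).
Proof.
move=> [f_lp [L fL]]; split=> [x Mx|]; first by apply: in_lpZ => //; exact: f_lp.
exists (modulus c * L) => x y Mx My.
under [X in lp_norm p X]eq_fun do rewrite -mulrBr.
rewrite lp_normZ// -mulrA EFinM.
by apply: lee_wpmul2l; [rewrite lee_fin modulus_ge0|exact: fL].
Qed.

(** * Series and synthesis operators *)

Lemma cvg_seriesD (t u : nat -> X) (l m : X) :
  series t @ \oo --> l -> series u @ \oo --> m ->
  series (fun n => t n + u n) @ \oo --> l + m.
Proof. by move=> tl um; rewrite [X in X @ _]seriesD; exact: cvgD. Qed.

Lemma synthesis_cvg tau a : synthesis_bounded p tau -> in_lp p a ->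
  series (fun n => a n *: tau n) @ \oo --> synthesis tau a.
Proof. by move=> [cv _ _] /cv. Qed.

(* Linearity of the synthesis operator is automatic once the series
   converge. *)
Lemma synthesis_bounded_cvg tau (T : (nat -> scalars R k) -> X) (L : R) :
  (forall a, in_lp p a -> series (fun n => a n *: tau n) @ \oo --> T a) ->
  (forall a, in_lp p a -> ((rnorm (T a))%:E <= L%:E * lp_norm p a)%E) ->
  synthesis_bounded p tau.
Proof.
move=> tauT TL.
have synT a : in_lp p a -> synthesis tau a = T a.
  by move=> /tauT; exact: cvg_lim.
split=> [a /tauT /cvgP //|c a b a_lp b_lp|].
  rewrite (synT a)// (synT b)//; apply: cvg_lim => //.
  under [X in series X]eq_fun do rewrite scalerDl -scalerA.
  apply: cvg_seriesD; last exact: tauT.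
  by rewrite [X in X @ _]seriesZ; apply: cvgZl_tmp; exact: tauT.
by exists L => a a_lp; rewrite synT//; exact: TL.
Qed.

Lemma synthesis_bounded_ge0 tau : synthesis_bounded p tau ->
  exists2 L : R, 0 <= L &
    forall a, in_lp p a ->
      ((rnorm (synthesis tau a))%:E <= L%:E * lp_norm p a)%E.
Proof.
move=> [_ _ [L tauL]]; exists `|L| => // a a_lp.
apply: le_trans (tauL _ a_lp) _.
by apply: lee_wpmul2r; [exact: lp_norm_ge0|rewrite lee_fin ler_norm].
Qed.

Lemma synthesis_bounded_linear C tau : bounded_operator C ->
  synthesis_bounded p tau -> synthesis_bounded p (C \o tau).
Proof.
move=> bC tau_bd; have [_ _ [L tauL]] := tau_bd.
have cC := bounded_operator_continuous _ bC; have [N CN] := bC.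
apply: (@synthesis_bounded_cvg _ (C \o synthesis tau) (modulus N * L)).
  by move=> a a_lp; apply: cvg_series_linear => //; exact: synthesis_cvg.
move=> a a_lp.
apply: (@le_trans _ _ (modulus N * rnorm (synthesis tau a))%:E).
  by rewrite lee_fin; apply: ler_rnormM; exact: CN.
rewrite !EFinM -muleA.
by apply: lee_wpmul2l; [rewrite lee_fin modulus_ge0|exact: tauL].
Qed.

Lemma synthesis_boundedD tau omega :
  synthesis_bounded p tau -> synthesis_bounded p omega ->
  synthesis_bounded p (fun n => tau n + omega n).
Proof.
move=> tau_bd omega_bd.
have [L L0 tauL] := synthesis_bounded_ge0 _ tau_bd.
have [N N0 omegaN] := synthesis_bounded_ge0 _ omega_bd.
apply: (@synthesis_bounded_cvg _
  (fun a => synthesis tau a + synthesis omega a) (L + N)) => a a_lp.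
  under [X in series X]eq_fun do rewrite scalerDr.
  by apply: cvg_seriesD; exact: synthesis_cvg.
apply: (@le_trans _ _ (rnorm (synthesis tau a) + rnorm (synthesis omega a))%:E).
  by rewrite lee_fin ler_rnormD.
(* Distributivity over an extended real factor is obtained from the nonnegativity of [L] and [N]. *)
rewrite !EFinD ge0_muleDl ?lee_fin//.
by apply: leeD; [exact: tauL|exact: omegaN].
Qed.

(** * Frames from expansions of the identity *)

Lemma lipschitz_pSF_in_space_pSF f tau : (forall n, M (tau n)) ->
  lipschitz_pSF_in_space M p f tau -> lipschitz_pSF M p f tau.
Proof.
move=> Mtau [f_lip f_an tau_bd ftau].
have SM x : M x -> frame_map f tau x = x by move=> /ftau; exact: cvg_lim.
have Sinj : {in M &, injective (frame_map f tau)}.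
  by move=> x y /set_mem Mx /set_mem My; rewrite !SM.
split=> //; split=> //; split=> [x /ftau /cvgP //||| x Mx].
- split=> [x Mx|//|x Mx]; first by rewrite SM.
  by exists x => //; exact: SM.
- by exists 1, 1; split=> // x y Mx My; rewrite !SM// !mul1r.
- under [X in series X]eq_fun => n.
    (* As [tau n] lies in [M], it is its own image under the frame map, so the inverse cancels and
       the reconstruction formula becomes the given expansion. *)
    rewrite -[X in 'pinv_(fun=> 0) M (frame_map f tau) X](SM _ (Mtau n)).
    rewrite pinvKV ?inE//.
    over.
  exact: ftau.
Qed.

Lemma lipschitz_pSF_cvg f tau x : lipschitz_pSF M p f tau -> M x ->
  series (fun n => f n x *: tau n) @ \oo --> x.
Proof.
by move=> [[_ _ _ _ [cv _ _ _]] SM] Mx; rewrite -[X in _ --> X]SM//; exact: cv.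
Qed.

(** Here [f] and [g] stand for the functionals already composed or scaled, and [P], [Q] for the
    limits of their series against [tau] and [omega]. *)
Lemma lipschitz_pSF_in_spaceD f g tau omega C D (P Q : X -> X) :
  (forall n, lipschitz_functional M (f n)) ->
  (forall n, lipschitz_functional M (g n)) ->
  analysis_lipschitz M p f -> analysis_lipschitz M p g ->
  synthesis_bounded p tau -> synthesis_bounded p omega ->
  bounded_operator C -> bounded_operator D ->
  (forall x, M x -> series (fun n => f n x *: tau n) @ \oo --> P x) ->
  (forall x, M x -> series (fun n => g n x *: omega n) @ \oo --> Q x) ->
  (forall x, M x -> series (fun n => g n x *: tau n) @ \oo --> (0 : X)) ->
  (forall x, M x -> series (fun n => f n x *: omega n) @ \oo --> (0 : X)) ->
  (forall x, M x -> C (P x) + D (Q x) = x) ->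
  lipschitz_pSF_in_space M p (fun n x => f n x + g n x)
    (fun n => C (tau n) + D (omega n)).
Proof.
move=> f_lip g_lip f_an g_an tau_bd omega_bd C_bd D_bd ftau gomega gtau fomega.
have cC := bounded_operator_continuous _ C_bd.
have cD := bounded_operator_continuous _ D_bd.
move=> CPDQ; split.
- by move=> n; exact: lipschitz_functionalD.
- exact: analysis_lipschitzD.
- by apply: synthesis_boundedD; exact: synthesis_bounded_linear.
move=> x Mx; 
(* The limit [x] is split into four terms in the order in which the product expands, the zeros being
   the mixed limits. *)
have CPDQx : (C (P x) + D 0) + (C 0 + D (Q x)) = x.
  by rewrite !linear0 addr0 add0r CPDQ.
rewrite -[X in _ --> X]CPDQx.
under [X in series X]eq_fun do rewrite scalerDl !scalerDr.
apply: cvg_seriesD; apply: cvg_seriesD; apply: cvg_series_linear => //.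
- exact: ftau.
- exact: fomega.
- exact: gtau.
- exact: gomega.
Qed.

End combinations.

(** [M] is not assumed closed under addition, so [sigma n] is a priori only a vector of [X]. Each
    case therefore gives the frame properties over [X], and the full definition once every [sigma n]
    lies in [M]. *)
Theorem theorem2p18 (R : realType) (k : scalar_kind)
    (X : completeNormedModType (scalars R k)) (M : set X) (p : R)
    (f g : nat -> X -> scalars R k) (tau omega : nat -> X)
    (M_nonempty : M !=set0) (p_ge1 : 1 <= p)
    (ftau_SF : lipschitz_pSF M p f tau)
    (gomega_SF : lipschitz_pSF M p g omega)
    (orth : orthogonal_pASF M g omega f tau) :
  (forall (A B : X -> X) (C D : {linear X -> X}),
      set_fun M M A -> set_fun M M B ->
      bi_lipschitz M A -> bi_lipschitz M B ->
      bounded_operator C -> bounded_operator D ->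
      set_fun M M C -> set_fun M M D ->
      (forall x, M x -> C (A x) + D (B x) = x) ->
      let h := fun n x => f n (A x) + g n (B x) in
      let sigma := fun n => C (tau n) + D (omega n) in
      lipschitz_pSF_in_space M p h sigma /\
      ((forall n, M (sigma n)) -> lipschitz_pSF M p h sigma)) /\
  (forall a b c d : scalars R k,
      c * a + d * b = 1 ->
      let h := fun n x => a * f n x + b * g n x in
      let sigma := fun n => c *: tau n + d *: omega n in
      lipschitz_pSF_in_space M p h sigma /\
      ((forall n, M (sigma n)) -> lipschitz_pSF M p h sigma)).
Proof.
have [[_ f_lip f_an tau_bd _] _] := ftau_SF.
have [[_ g_lip g_an omega_bd _] _] := gomega_SF.
have ftau x (Mx : M x) := lipschitz_pSF_cvg _ _ _ _ _ ftau_SF Mx.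
have gomega x (Mx : M x) := lipschitz_pSF_cvg _ _ _ _ _ gomega_SF Mx.
have gtau x (Mx : M x) := (orth x Mx).1.
have fomega x (Mx : M x) := (orth x Mx).2.
split=> [A B C D MA MB A_bl B_bl C_bd D_bd _ _ CADB h sigma|a b c d cadb h sigma].
  suff H : lipschitz_pSF_in_space M p h sigma.
    by split=> // Msigma; exact: lipschitz_pSF_in_space_pSF.
  (* The expansions and the orthogonality relations, taken at the points [A x] and [B x] of [M],
     give [P = A], [Q = B] and zero mixed limits. *)
  apply: (lipschitz_pSF_in_spaceD _ _ _ _ (fun n => f n \o A)
    (fun n => g n \o B) _ _ _ _ A B) => //.
  - by move=> n; exact: lipschitz_functional_comp.
  - by move=> n; exact: lipschitz_functional_comp.
  - exact: analysis_lipschitz_comp.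
  - exact: analysis_lipschitz_comp.
  - by move=> x Mx; exact: ftau (MA _ Mx).
  - by move=> x Mx; exact: gomega (MB _ Mx).
  - by move=> x Mx; exact: gtau (MB _ Mx).
  - by move=> x Mx; exact: fomega (MA _ Mx).
suff H : lipschitz_pSF_in_space M p h sigma.
  by split=> // Msigma; exact: lipschitz_pSF_in_space_pSF.
have cvgZ (u : nat -> X -> scalars R k) (t : nat -> X) e x l :
    series (fun n => u n x *: t n) @ \oo --> l ->
    series (fun n => (e * u n x) *: t n) @ \oo --> e *: l.
  move=> utl; under [X in series X]eq_fun do rewrite -scalerA.
  by rewrite [X in X @ _]seriesZ; exact: cvgZl_tmp.
(* All four maps are now multiplications by scalars: [c] and [d] as operators, [a] and [b] as [P]
   and [Q]. *)
apply: (lipschitz_pSF_in_spaceD _ _ _ _ (fun n x => a * f n x)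
  (fun n x => b * g n x) _ _ (@GRing.scale _ X c : {linear X -> X})
  (@GRing.scale _ X d : {linear X -> X}) ( *:%R a) ( *:%R b)) => //.
- by move=> n; exact: lipschitz_functionalZ.
- by move=> n; exact: lipschitz_functionalZ.
- exact: analysis_lipschitzZ.
- exact: analysis_lipschitzZ.
- exact: bounded_operator_scale.
- exact: bounded_operator_scale.
- by move=> x Mx; apply: cvgZ; exact: ftau.
- by move=> x Mx; apply: cvgZ; exact: gomega.
(* The zero limit is written as a multiple of zero to match [cvgZ]. *)
- by move=> x Mx; rewrite -(scaler0 X b); apply: cvgZ; exact: gtau.
- by move=> x Mx; rewrite -(scaler0 X a); apply: cvgZ; exact: fomega.
- by move=> x Mx /=; rewrite !scalerA -scalerDl cadb scale1r.
Qed.
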